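(* Let $E=\oplus_{i\in\mathbb Z}E_i$ be a graded vector space, let $\mu$ be a (possibly curved) $L_\infty$-structure on $E$, and let $\mathcal N$ be a symmetric vector valued form on $E$ of degree zero. Then $\mathcal N$ is weak Nijenhuis with respect to $\mu$ if and only if $[\mathcal N,\mu]_{_{RN}}$ is a (possibly curved) $L_\infty$-structure on $E$.
   Context: Base field $\mathbb K=\mathbb R$ or $\mathbb C$; $E=\oplus_{i\in\mathbb Z}E_i$ graded vector space; $|X|$ is the degree of a homogeneous $X$. A symmetric vector valued $k$-form ($k\ge 0$) is a graded symmetric $k$-linear map $K:E\times\cdots\times E\to E$ (for $k=0$, an element of $E$). It has degree $\bar K$ if $|K(X_1,\dots,X_k)|=|X_1|+\cdots+|X_k|+\bar K$ (for $X\in E$, $\bar X=|X|$). A symmetric vector valued form is a formal sum $\sum_{k\ge0}K_k$ of vector valued $k$-forms; it has degree $d$ if all $K_k$ do. Insertion: for a $k$-form $K$ and an $l$-form $L$ with $l\ge1$, $$\iota_KL(X_1,\dots,X_{k+l-1})=\sum_{\sigma\in Sh(k,l-1)}\epsilon(\sigma)L(K(X_{\sigma(1)},\dots,X_{\sigma(k)}),X_{\sigma(k+1)},\dots,X_{\sigma(k+l-1)}),$$ where $Sh(k,l-1)$ is the set of $(k,l-1)$-unshuffles and $\epsilon(\sigma)$ is the Koszul sign ($X_{\sigma(1)}\cdots X_{\sigma(n)}=\epsilon(\sigma)X_1\cdots X_n$ in the graded symmetric algebra); $\iota_KL=0$ if $L\in E$; and $\iota_XK=K(X,\cdot,\dots,\cdot)$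 for $X\in E$. Richardson-Nijenhuis bracket: $[K,L]_{_{RN}}=\iota_KL-(-1)^{\bar K\bar L}\iota_LK$, extended to formal sums. An $L_\infty$-structure is a sum $\mu=\sum_{i\ge1}l_i$ of symmetric vector valued $i$-forms $l_i$ of degree $1$ with $\sum_{i+j=n+1}\sum_{\sigma\in Sh(i,j-1)}\epsilon(\sigma)l_j(l_i(X_{\sigma(1)},\dots,X_{\sigma(i)}),\dots,X_{\sigma(n)})=0$ for all $n\ge1$. A curved $L_\infty$-structure is a sum $\mu=\sum_{i\ge0}l_i$ of such forms, with in addition $l_0\in E_1$ (the curvature, possibly zero), such that $l_1(l_0)=0$ and for all $n\geq 1$ one has $l_{n+1}(l_0,X_1,\dots,X_n)+\sum_{i+j=n+1,\,i,j\ge1}\sum_{\sigma\in Sh(i,j-1)}\epsilon(\sigma)l_j(l_i(X_{\sigma(1)},\dots,X_{\sigma(i)}),\dots,X_{\sigma(n)})=0$. ''Possibly curved'' means curved with $l_0$ allowed to be zero or not. A degree-zero form $\mathcal N$ is weak Nijenhuis with respect to $\mu$ if $[\mu,[\mathcal N,[\mathcal N,\mu]_{_{RN}}]_{_{RN}}]_{_{RN}}=0$. *)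

(* Defs.v *)
From HB Require Import structures.
From mathcomp Require Import all_boot all_order all_algebra.
From mathcomp Require Import all_fingroup.
From mathcomp Require Import all_classical all_reals.
From mathcomp Require Import complex.
Set Implicit Arguments. Unset Strict Implicit. Unset Printing Implicit Defensive.
Import Order.TTheory GRing.Theory Num.Theory.
Local Open Scope classical_set_scope.
Local Open Scope ring_scope.

(* E is the internal direct sum of the subspaces [part i].  The sum over
   [set: int] is the finitely supported one of fsbigop (it is 0 when the
   support is infinite, hence the explicit finiteness condition). *)
Record gradedSpace (K : fieldType) := GradedSpace {
  gr_carrier :> lmodType K;
  part : int -> set gr_carrier;
  part0 : forall i, part i 0;
  partP : forall i (a : K) (x y : gr_carrier),
    part i x -> part i y -> part i (a *: x + y);
  part_decomp : forall x : gr_carrier, exists! c : int -> gr_carrier,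
    [/\ forall i, part i (c i),
        finite_set [set i | c i != 0]
      & x = \sum_(i \in [set: int]) c i]
}.

Definition component (K : fieldType) (E : gradedSpace K) (i : int) (x : E) : E :=
  projT1 (cid (part_decomp x)) i.

Definition permute (T : Type) (n : nat) (s : 'S_n) (X : n.-tuple T) : n.-tuple T :=
  [tuple tnth X (s i) | i < n].

Definition unshuffle (n k : nat) (s : 'S_n) : bool :=
  [forall i : 'I_n, forall j : 'I_n,
     ((i < j) && ((j < k) || (k <= i)))%N ==> (s i < s j)%N].

(* The sign e with X_(s 1) ... X_(s n) = e X_1 ... X_n in the graded symmetric
   algebra, for X_i of degree d_i: one factor for each pair of elements
   that are exchanged. *)
Definition koszul (K : fieldType) (n : nat) (d : n.-tuple int) (s : 'S_n) : K :=
  \prod_(i < n) \prod_(j < n | (i < j)%N && (s j < s i)%N)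
     (-1) ^ (tnth d (s i) * tnth d (s j)).

(* A formal sum K_0 + K_1 + K_2 + ... of maps K_k : E^k -> E is encoded as one
   function on finite sequences: K_k is its restriction to the sequences of
   length k, and K_0 is the element [K [::]] of E. *)
Definition vmap (K : fieldType) (E : gradedSpace K) : Type := seq E -> E.

Section Forms.
Variables (K : fieldType) (E : gradedSpace K).
Implicit Types (F G : vmap E) (deg : int).

Definition homogeneous (n : nat) (d : n.-tuple int) (X : n.-tuple E) : Prop :=
  forall i : 'I_n, part (tnth d i) (tnth X i).

Definition multilinear F : Prop :=
  forall (s t : seq E) (a : K) (x y : E),
    F (s ++ (a *: x + y) :: t) = a *: F (s ++ x :: t) + F (s ++ y :: t).

Definition graded_symmetric F : Prop :=
  forall (n : nat) (d : n.-tuple int) (X : n.-tuple E) (s : 'S_n),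
    homogeneous d X -> F (permute s X) = koszul K d s *: F X.

Definition has_degree deg F : Prop :=
  forall (n : nat) (d : n.-tuple int) (X : n.-tuple E),
    homogeneous d X -> part (\sum_(i < n) tnth d i + deg) (F X).

Definition vform deg F : Prop :=
  [/\ multilinear F, graded_symmetric F & has_degree deg F].

(* For X_i homogeneous of degree d_i, the sum over the (k, n - k)-unshuffles s
   of  koszul(s) G(F(X_(s 1), ..., X_(s k)), X_(s (k+1)), ..., X_(s n)). *)
Definition unshuffle_sum (k : nat) F G (n : nat)
    (d : n.-tuple int) (X : n.-tuple E) : E :=
  \sum_(s : 'S_n | unshuffle k s)
     koszul K d s *: G (F (take k (permute s X)) :: drop k (permute s X)).

(* Insertion of F into G.  In arity n it collects the insertions of F_k into
   G_l with k + l - 1 = n and l >= 1, that is 0 <= k <= n.  Koszul signs only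
   make sense on homogeneous arguments; the value at an arbitrary X is obtained
   by expanding each X_i into its components X_i = \sum_(d_i) (X_i)_(d_i). *)
Definition insertion F G : vmap E := fun X =>
  \sum_(d \in [set: (size X).-tuple int]) \sum_(k < (size X).+1)
     unshuffle_sum k F G d
       [tuple component (tnth d i) (tnth (in_tuple X) i) | i < size X].

(* The Richardson-Nijenhuis bracket of F of degree dF and G of degree dG. *)
Definition rn_bracket (dF dG : int) F G : vmap E := fun X =>
  insertion F G X - (-1) ^ (dF * dG) *: insertion G F X.

(* Possibly curved: the curvature [mu [::]] may vanish or not; it lies in E_1
   by the case n = 0 of [has_degree 1 mu]. *)
Definition curved_Linfty (mu : vmap E) : Prop :=
  [/\ vform 1 mu,
      mu [:: mu [::]] = 0
    & forall (n : nat) (d : n.-tuple int) (X : n.-tuple E),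
        (1 <= n)%N -> homogeneous d X ->
        mu (mu [::] :: X)
          + \sum_(1 <= i < n.+1) unshuffle_sum i mu mu d X = 0].

Definition weak_nijenhuis (mu N : vmap E) : Prop :=
  forall X : seq E,
    rn_bracket 1 1 mu (rn_bracket 0 1 N (rn_bracket 0 1 N mu)) X = 0.

End Forms.

(* Main.v *)
Require Import Defs.
From mathcomp Require Import all_boot all_order all_algebra.
From mathcomp Require Import all_fingroup.
From mathcomp Require Import all_classical all_reals.
From mathcomp Require Import complex.
From mathcomp Require Import zify ring.
Set Implicit Arguments. Unset Strict Implicit. Unset Printing Implicit Defensive.
Import Order.TTheory GRing.Theory Num.Theory.
Local Open Scope classical_set_scope.
Local Open Scope ring_scope.

(** Write F.G for the insertion of F into G and d_z F = F(z, ...).  Separating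
  the unshuffles according to the place of the first argument z gives the
  derivation rule d_z (F.G) = (d_z F).G + (-1)^(|z||F|) F.(d_z G).  The
  associator F.(G.H) - (F.G).H then obeys such a rule in its three arguments,
  so by induction on the number of arguments it is graded symmetric in F and G
  (the pre-Lie identity), the induction starting from H(F, G) for 0-forms.
  Being a curved L_infinity-structure means mu.mu = 0.  With A = [N, mu] and
  B = [N, A], the pre-Lie identity yields mu.(mu.N) = 0 and A.mu + mu.A = 0,
  and then [mu, B] = - 2 A.A. *)

(** * Permutations and unshuffles, split by the place of the first argument *)

Lemma lift_perm_bij n :
  bijective (fun p : 'I_n.+1 * 'S_n => lift_perm p.1 ord0 p.2).
Proof.
apply: inj_card_bij; last by rewrite card_prod card_ord !card_Sn factS.
move=> [j s] [j' s'] /= E.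
have jj' : j = j'.
  apply: (@perm_inj _ (lift_perm j' ord0 s')).
  by rewrite -{1}E !lift_perm_id.
subst j'; congr (_, _); apply/permP => i.
by apply: (@lift_inj _ ord0); rewrite -!(lift_perm_lift j) E.
Qed.

(** The index [j] is the place at which the first argument ends up, and [s] arranges the other
    arguments; this is the induction step for sums over unshuffles. *)
Lemma big_lift_perm (V : nmodType) n (P : pred 'S_n.+1) (f : 'S_n.+1 -> V) :
  \sum_(s | P s) f s =
  \sum_(j < n.+1) \sum_(s | P (lift_perm j ord0 s)) f (lift_perm j ord0 s).
Proof.
rewrite (reindex (fun p : 'I_n.+1 * 'S_n => lift_perm p.1 ord0 p.2)) /=; last first.
  exact/onW_bij/lift_perm_bij.
by rewrite (pair_big_dep xpredT (fun j s => P (lift_perm j ord0 s))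
                (fun j s => f (lift_perm j ord0 s))).
Qed.

Lemma nth_permute (T : Type) n (s : 'S_n) (X : n.-tuple T) x0 (i : 'I_n) :
  nth x0 (permute s X) i = tnth X (s i).
Proof. by rewrite -tnth_nth tnth_mktuple. Qed.

Lemma permute1 (T : Type) n (X : n.-tuple T) : permute 1%g X = X.
Proof. by apply: eq_from_tnth => i; rewrite tnth_mktuple perm1. Qed.

Lemma permute_map (T U : Type) (f : T -> U) n (s : 'S_n) (X : n.-tuple T) :
  permute s (map_tuple f X) = map_tuple f (permute s X).
Proof. by apply: eq_from_tnth => i; rewrite !(tnth_map, tnth_mktuple). Qed.

Lemma permute_lift_perm (T : Type) n (j : 'I_n.+1) (s : 'S_n) z (Z : n.-tuple T) :
  permute (lift_perm j ord0 s) [tuple of z :: Z] =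
  take j (permute s Z) ++ z :: drop j (permute s Z) :> seq T.
Proof.
have jn : (j <= n)%N by rewrite -ltnS.
have szj : size (take j (permute s Z)) = j by rewrite size_takel ?size_tuple.
apply: (@eq_from_nth _ z).
  by rewrite [LHS]size_tuple size_cat szj /= size_drop size_tuple card_ord addnS subnKC.
move=> i; rewrite [X in (_ < X)%N]size_tuple => lti; rewrite -[ i ]/(val (Ordinal lti)).
rewrite nth_permute nth_cat szj; case: (unliftP j (Ordinal lti)) => [i' ->|->].
  rewrite lift_perm_lift tnthS /= /bump; case: (leqP j i') => /= ji.
    rewrite ltnNge (leq_trans ji) ?leq_addl //= add1n subSn //= nth_drop.
    by rewrite subnKC // nth_permute.
  by rewrite ji nth_take // nth_permute.
by rewrite lift_perm_id ltnn subnn /= tnth0.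
Qed.

(** An unshuffle with empty first block is increasing, and the increasing list of all its values can
    only be that of the identity. *)
Lemma unshuffle0_eq n (s : 'S_n) : unshuffle 0 s = (s == 1%g).
Proof.
apply/idP/eqP => [/forallP us | ->]; last first.
  by apply/forallP=> i; apply/forallP=> j; rewrite !perm1; apply/implyP=> /andP[].
apply/permP => i; rewrite perm1; apply: val_inj.
have incr (a b : 'I_n) : (a < b)%N -> (s a < s b)%N.
  by move=> ab; have /forallP/(_ b)/implyP := us a; apply; rewrite ab orbT.
have e : [seq val (s a) | a <- enum 'I_n] = [seq val a | a <- enum 'I_n].
  apply: (irr_sorted_eq ltn_trans ltnn).
  - rewrite sorted_map; apply: (sub_sorted (e := relpre val ltn)) => [a b /incr //|].
    by rewrite -sorted_map val_enum_ord iota_ltn_sorted.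
  - by rewrite val_enum_ord iota_ltn_sorted.
  - move=> m; apply/mapP/mapP=> [] [a _ ->].
      by exists (s a); rewrite ?mem_enum.
    by exists (s^-1 a)%g; rewrite ?mem_enum // permKV.
by move/eq_in_map: e; apply; rewrite mem_enum.
Qed.

Lemma unshuffle_lift_perm0 n k (s : 'S_n) :
  unshuffle k.+1 (lift_perm ord0 ord0 s) = unshuffle k s.
Proof.
apply/forallP/forallP => us i; apply/forallP => j; apply/implyP.
  move=> h; have /forallP/(_ (lift ord0 j))/implyP := us (lift ord0 i).
  by rewrite !lift_perm_lift /= /bump !leq0n !add1n !ltnS; apply.
case: (unliftP ord0 j) => [j' ->|->] //.
case: (unliftP ord0 i) => [i' ->|->]; last by rewrite lift_perm_id lift_perm_lift.
rewrite !lift_perm_lift /= /bump !leq0n !add1n !ltnS => h.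
by have /forallP/(_ j')/implyP := us i'; apply.
Qed.

Lemma unshuffle_lift_permk n (k : 'I_n.+1) (s : 'S_n) :
  unshuffle k (lift_perm k ord0 s) = unshuffle k s.
Proof.
apply/forallP/forallP => us i; apply/forallP => j; apply/implyP.
  move=> h; have /forallP/(_ (lift k j))/implyP := us (lift k i).
  rewrite !lift_perm_lift /= /bump !leq0n !add1n !ltnS; apply.
  by move: h; lia.
case: (unliftP k j) => [j' ->|->]; last first.
  by move=> /=; lia.
case: (unliftP k i) => [i' ->|->]; last by rewrite lift_perm_id lift_perm_lift.
rewrite !lift_perm_lift /= /bump !leq0n !add1n !ltnS => h.
by have /forallP/(_ j')/implyP := us i'; apply; move: h; lia.
Qed.

(** Both blocks of an unshuffle are increasing, so the least value can only stand at the head of a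
    block, that is at place [0] or [k]. The two preceding lemmas treat these places. *)
Lemma unshuffle_lift_perm_neq n k (j : 'I_n.+1) (s : 'S_n) :
  j != ord0 -> j != k :> nat -> unshuffle k (lift_perm j ord0 s) = false.
Proof.
move=> j0 jk; apply/negP => /forallP us.
have j_gt0 : (0 < j)%N by rewrite lt0n.
case: (ltnP j k) => hjk.
  have /forallP/(_ j)/implyP := us ord0.
  by rewrite lift_perm_id ltn0 => h; apply: notF; apply: h; rewrite j_gt0 hjk.
have kj : (k < j)%N by rewrite ltn_neqAle eq_sym jk.
have /forallP/(_ j)/implyP := us (Ordinal (ltn_trans kj (ltn_ord j))).
by rewrite lift_perm_id ltn0 => h; apply: notF; apply: h; rewrite /= kj leqnn orbT.
Qed.

(** * Koszul signs *)

Section Sign.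
Variable K : fieldType.

Definition ksign (m : int) : K := (-1) ^ m.

Lemma ksignD m n : ksign (m + n) = ksign m * ksign n.
Proof. by rewrite /ksign expfzDr // oppr_eq0 oner_eq0. Qed.

Lemma ksign0 : ksign 0 = 1. Proof. by []. Qed.

Lemma ksign_sqr m : ksign m * ksign m = 1.
Proof. by rewrite /ksign -expfzMl mulrNN mulr1 exp1rz. Qed.

(** Turns a comparison of exponents modulo 2 into an integer identity, with half of the even
    difference supplied as [k]. *)
Lemma eq_ksign k m n : m = n + (k + k) -> ksign m = ksign n.
Proof. by move=> ->; rewrite !ksignD ksign_sqr mulr1. Qed.

Lemma ksign_sum I (r : seq I) (P : pred I) (f : I -> int) :
  ksign (\sum_(i <- r | P i) f i) = \prod_(i <- r | P i) ksign (f i).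
Proof. exact: (big_morph ksign ksignD ksign0). Qed.

(** The first argument is exchanged exactly with the [j] arguments that now precede it, which gives
    the first factor; the pairs not involving it give the sign of [s]. *)
Lemma koszul_lift_perm n (j : 'I_n.+1) (s : 'S_n) d0 (d : n.-tuple int) :
  koszul K [tuple of d0 :: d] (lift_perm j ord0 s) =
  ksign (d0 * \sum_(a <- take j (permute s d)) a) * koszul K d s.
Proof.
have jn : (j <= n)%N by rewrite -ltnS.
have -> : \sum_(a <- take j (permute s d)) a = \sum_(i < n | (i < j)%N) tnth d (s i).
  rewrite (big_nth 0) size_takel ?size_tuple // (big_nat_widen _ _ n) //=.
  rewrite big_mkord; apply: eq_bigr => i ij.
  by rewrite nth_take // nth_permute.
rewrite mulr_sumr ksign_sum [RHS]mulrC /koszul.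
rewrite (bigD1_ord j) //= big1 ?mul1r; last first.
  by move=> i; rewrite lift_perm_id andbF.
rewrite [X in _ * X]big_mkcond -big_split; apply: eq_bigr => i _ /=.
rewrite !(big_mkcond (fun _ => _ && _)) (bigD1_ord j) //=.
rewrite lift_perm_id lift_perm_lift tnthS tnth0 [LHS]mulrC; congr (_ * _); last first.
  have -> : (bump j i < j)%N = (i < j)%N by rewrite /bump; lia.
  by rewrite andbT /ksign mulrC.
apply: eq_bigr => i' _; rewrite lift_perm_lift tnthS /= /bump !add1n ltnS.
by have -> : ((j <= i) + i < (j <= i') + i')%N = (i < i')%N by lia.
Qed.

Lemma koszul1 n (d : n.-tuple int) : koszul K d 1%g = 1.
Proof.
rewrite /koszul big1 // => i _; rewrite big1 // => j.
by rewrite !perm1 => /andP[/ltnW]; rewrite leqNgt => /negP.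
Qed.

End Sign.

(** * Sums over unshuffles as a recursion on the list of arguments *)

Section SplitSum.
Variables (K : fieldType) (V : lmodType K).

(* A sum over unshuffles in recursive form: each entry of Z goes either to A, or
   to B and then moves past the later entries that go to A. *)
Fixpoint split_sum (T : Type) (dg : T -> int) (Phi : seq T -> seq T -> V)
    (Z : seq T) : V :=
  if Z is z :: Z' then
    split_sum dg (fun A B => Phi (z :: A) B) Z'
    + split_sum dg (fun A B => ksign K (dg z * \sum_(a <- A) dg a) *: Phi A (z :: B)) Z'
  else Phi [::] [::].

Lemma eq_split_sum (T : Type) (dg : T -> int) Phi Psi Z :
  Phi =2 Psi -> split_sum dg Phi Z = split_sum dg Psi Z.
Proof. by move=> e; have -> // : Phi = Psi by apply/funext => A; apply/funext. Qed.

Lemma split_sumP (T : Type) (dg : T -> int) a Phi Psi Z :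
  split_sum dg (fun A B => a *: Phi A B + Psi A B) Z =
  a *: split_sum dg Phi Z + split_sum dg Psi Z.
Proof.
elim: Z Phi Psi => //= z Z IH Phi Psi.
rewrite IH scalerDr [RHS]addrACA; congr (_ + _); rewrite -[RHS]IH.
by apply: eq_split_sum => A B; rewrite scalerDr !scalerA mulrC.
Qed.

Lemma split_sum0 (T : Type) (dg : T -> int) Z :
  split_sum dg (fun _ _ => 0 : V) Z = 0.
Proof.
have := split_sumP dg (-1) (fun _ _ => 0) (fun _ _ => 0) Z.
by rewrite scaler0 addr0 scaleN1r addNr.
Qed.

Lemma split_sumZ (T : Type) (dg : T -> int) a Phi Z :
  split_sum dg (fun A B => a *: Phi A B) Z = a *: split_sum dg Phi Z.
Proof.
rewrite -[RHS]addr0 -(split_sum0 dg Z) -split_sumP.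
by apply: eq_split_sum => A B; rewrite addr0.
Qed.

Lemma split_sum_map (T U : Type) (dgT : T -> int) (dgU : U -> int) (f : T -> U)
    Phi Z : (forall z, dgU (f z) = dgT z) ->
  split_sum dgU Phi (map f Z) = split_sum dgT (fun A B => Phi (map f A) (map f B)) Z.
Proof.
move=> fdg; elim: Z Phi => //= z Z IH Phi; rewrite !IH; congr (_ + _).
apply: eq_split_sum => A B; rewrite fdg big_map.
by under eq_bigr do rewrite fdg.
Qed.

(** Induction on [n]: the first entry heads either the first block ([j = 0], [k > 0]) or the second
    one ([j = k]), and these are the two summands of the recursion. *)
Lemma sum_unshuffleE (T : Type) (dg : T -> int) Phi n (Z : n.-tuple T) :
  \sum_(k < n.+1) \sum_(s | unshuffle k s)
     koszul K (map_tuple dg Z) s *: Phi (take k (permute s Z)) (drop k (permute s Z))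
  = split_sum dg Phi Z.
Proof.
elim: n Phi Z => [|n IH] Phi Z.
  rewrite big_ord_recl big_ord0 addr0 (big_pred1 1%g); last exact: unshuffle0_eq.
  by rewrite /koszul big_ord0 scale1r [permute _ _]tuple0 [Z]tuple0.
case/tupleP: Z => z Z /=.
have mapZ : map_tuple dg [tuple of z :: Z] = [tuple of dg z :: map_tuple dg Z].
  exact: val_inj.
pose term (k : nat) (j : 'I_n.+1) := \sum_(s | unshuffle k (lift_perm j ord0 s))
  koszul K (map_tuple dg [tuple of z :: Z]) (lift_perm j ord0 s) *:
  Phi (take k (permute (lift_perm j ord0 s) [tuple of z :: Z]))
      (drop k (permute (lift_perm j ord0 s) [tuple of z :: Z])).
have term0 k j : j != ord0 -> j != k :> nat -> term k j = 0.
  by move=> j0 jk; rewrite /term big_pred0 // => s; rewrite unshuffle_lift_perm_neq.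
rewrite (eq_bigr (fun k : 'I_n.+2 => \sum_j term k j)); last first.
  by move=> k _; rewrite big_lift_perm.
rewrite exchange_big big_ord_recl big_ord_recl /=.
have -> : \sum_(i < n) \sum_(k < n.+2) term k (lift ord0 i) =
          \sum_(i < n) term (lift ord0 i) (lift ord0 i).
  apply: eq_bigr => i _.
  rewrite (bigD1 (widen_ord (leqnSn _) (lift ord0 i))) //= big1 ?addr0 // => k ki.
  by apply: term0 => //; apply: contra ki => /eqP e; apply/eqP/val_inj.
(* The term [j = k = 0], whose first block is empty, joins the diagonal terms, where [z] heads the
   second block. *)
rewrite addrAC -(big_ord_recl _ (fun i : 'I_n.+1 => term i i)) addrC; congr (_ + _).
  rewrite -IH; apply: eq_bigr => k _; rewrite /term.
  apply: eq_big => [s|s _]; first exact: unshuffle_lift_perm0.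
  rewrite mapZ koszul_lift_perm permute_lift_perm !take0 big_nil mulr0.
  by rewrite ksign0 mul1r /= drop0.
rewrite -IH; apply: eq_bigr => k _; rewrite /term.
apply: eq_big => [s|s _]; first exact: unshuffle_lift_permk.
rewrite mapZ koszul_lift_perm permute_lift_perm permute_map.
have kn : (k <= n)%N by rewrite -ltnS.
have szk : size (take k (permute s Z)) = k by rewrite size_takel ?size_tuple.
rewrite /= -map_take big_map take_cat drop_cat szk ltnn subnn take0 cats0 drop0.
by rewrite scalerA mulrC.
Qed.

End SplitSum.

(** * Finite supports and homogeneous components *)

Lemma finite_set_tuple (T : choiceType) n (A : 'I_n -> set T) :
  (forall i, finite_set (A i)) ->
  finite_set [set t : n.-tuple T | forall i, A i (tnth t i)].
Proof.
elim: n A => [|n IH] A finA.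
  by apply: (sub_finite_set _ (finite_set1 [tuple])) => t _ /=; rewrite tuple0.
have fin := IH (fun i => A (lift ord0 i)) (fun i => finA (lift ord0 i)).
apply: sub_finite_set (finite_image
  (fun p : T * n.-tuple T => [tuple of p.1 :: p.2]) (finite_setX (finA ord0) fin)).
move=> t; case/tupleP: t => x t At /=; exists (x, t) => //=; split => /=.
  by have := At ord0; rewrite tnth0.
by move=> i; have := At (lift ord0 i); rewrite tnthS.
Qed.

Section Components.
Variables (K : fieldType) (E : gradedSpace K).
Implicit Types (x y : E) (i : int).

Definition supp x : set int := [set i | component i x != 0].

Lemma componentP x :
  [/\ forall i, part i (component i x), finite_set (supp x)
    & x = \sum_(i \in [set: int]) component i x].
Proof. by rewrite /supp /component; case: cid => c []. Qed.

Lemma component_unique x (c : int -> E) :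
  (forall i, part i (c i)) -> finite_set [set i | c i != 0] ->
  x = \sum_(i \in [set: int]) c i -> forall i, component i x = c i.
Proof.
move=> pc fc xc i; rewrite /component; case: cid => c' /= [_ u].
by rewrite (u c).
Qed.

Lemma fsbig_finite_support (T : choiceType) (A : set T) (f : T -> E) :
  finite_set A -> (forall t, f t != 0 -> A t) ->
  \sum_(t \in [set: T]) f t = \sum_(t <- finmap.enum_fset (fset_set A)) f t.
Proof.
move=> finA fA; rewrite -fsbig_finite //; apply/esym/fsbig_widen => // t [_ nA].
by apply/eqP; apply: contra_notT nA; exact: fA.
Qed.

(** Since a sum with infinite support is 0 by convention, linearity is proved on one finite set [A]
    that contains both supports. *)
Lemma fsbig_linear (T : choiceType) (A : set T) a (f g h : T -> E) :
  finite_set A -> (forall t, f t != 0 -> A t) -> (forall t, g t != 0 -> A t) ->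
  (forall t, h t = a *: f t + g t) ->
  \sum_(t \in [set: T]) h t =
  a *: \sum_(t \in [set: T]) f t + \sum_(t \in [set: T]) g t.
Proof.
move=> finA fA gA hE; rewrite !(fsbig_finite_support finA) //.
  by rewrite scaler_sumr -big_split; apply: eq_bigr => t _.
move=> t; rewrite hE => h0; apply: contrapT => nA; move: h0.
have /negPn/eqP -> : ~~ (f t != 0) by apply/negP => /fA /nA.
have /negPn/eqP -> : ~~ (g t != 0) by apply/negP => /gA /nA.
by rewrite scaler0 addr0 eqxx.
Qed.

Lemma component_linear i a x y :
  component i (a *: x + y) = a *: component i x + component i y.
Proof.
have [px fx xE] := componentP x; have [py fy yE] := componentP y.
have fU : finite_set (supp x `|` supp y) by rewrite finite_setU.
apply: (component_unique (c := fun i => a *: component i x + component i y)).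
- by move=> j; apply: partP.
- apply: sub_finite_set fU => j /=; apply: contraTP => /not_orP[].
  move=> /negP/negPn/eqP -> /negP/negPn/eqP ->.
  by rewrite scaler0 addr0 eqxx.
- rewrite {1}xE {1}yE; apply/esym/(fsbig_linear fU) => //.
    by move=> j; left.
  by move=> j; right.
Qed.

Lemma component_part p x i :
  part p x -> component i x = if i == p then x else 0.
Proof.
move=> px; apply: (component_unique (c := fun i => if i == p then x else 0)).
- by move=> j; case: eqP => [->|_] //; apply: part0.
- apply: sub_finite_set (finite_set1 p) => j /=; case: (j =P p) => // _.
  by rewrite eqxx.
- rewrite (fsbig_finite_support (finite_set1 p)); last first.
    by move=> j /=; case: (j =P p) => // _; rewrite eqxx.
  by rewrite -fsbig_finite ?fsbig_set1 ?eqxx.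
Qed.

Lemma partD p x y : part p x -> part p y -> part p (x + y).
Proof. by move=> px py; rewrite -[x]scale1r; apply: partP. Qed.

Lemma partZ p a x : part p x -> part p (a *: x).
Proof. by move=> px; rewrite -[a *: x]addr0; apply: partP => //; apply: part0. Qed.

End Components.

(** * Multilinearity of the insertion *)

Section Insertion.
Variables (K : fieldType) (E : gradedSpace K).
Implicit Types (F G : vmap E).

Lemma multilinear_slot0 F s t : multilinear F -> F (s ++ 0 :: t) = 0.
Proof.
move=> mF; have := mF s t (-1) 0 0.
by rewrite scaler0 addr0 scaleN1r addNr.
Qed.

(** Entries are vectors labelled by a degree. Signs read only the label, so linearity is in the
    vector with the label held fixed. *)
Definition bimultilinear (Phi : seq (int * E) -> seq (int * E) -> E) : Prop :=
  (forall A A' B p a x y, Phi (A ++ (p, a *: x + y) :: A') B =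
     a *: Phi (A ++ (p, x) :: A') B + Phi (A ++ (p, y) :: A') B) /\
  (forall A B B' p a x y, Phi A (B ++ (p, a *: x + y) :: B') =
     a *: Phi A (B ++ (p, x) :: B') + Phi A (B ++ (p, y) :: B')).

Lemma split_sum_multilinear Phi S U p a x y : bimultilinear Phi ->
  split_sum fst Phi (S ++ (p, a *: x + y) :: U) =
  a *: split_sum fst Phi (S ++ (p, x) :: U) + split_sum fst Phi (S ++ (p, y) :: U).
Proof.
elim: S Phi => [|z S IH] Phi [ml mr] /=.
  rewrite scalerDr [RHS]addrACA -2!split_sumP; congr (_ + _).
    by apply: eq_split_sum => A B; apply: (ml [::]).
  apply: eq_split_sum => A B; rewrite (mr A [::]) /=.
  by rewrite scalerDr !scalerA mulrC.
rewrite scalerDr [RHS]addrACA -!IH //; split.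
- move=> A A' B q b u v; rewrite ml !big_cat !big_cons /=.
  by rewrite scalerDr !scalerA mulrC.
- move=> A B B' q b u v; rewrite (mr A (z :: B)) /=.
  by rewrite scalerDr !scalerA mulrC.
- by move=> A A' B q b u v; exact: (ml (z :: A)).
- by move=> A B B' q b u v; rewrite mr.
Qed.

Definition insert_term F G (A B : seq (int * E)) : E :=
  G (F (map snd A) :: map snd B).

Lemma insert_term_bimultilinear F G :
  multilinear F -> multilinear G -> bimultilinear (insert_term F G).
Proof.
move=> mF mG; split=> [A A' B|A B B'] p a x y; rewrite /insert_term !map_cat /=.
  by rewrite mF (mG [::]).
by rewrite -!cat_cons mG.
Qed.

Lemma sum_unshuffle_sum F G n (d : n.-tuple int) (X : n.-tuple E) :
  \sum_(k < n.+1) unshuffle_sum k F G d X = split_sum fst (insert_term F G) (zip d X).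
Proof.
rewrite -[zip d X]/(tval (zip_tuple d X)) -sum_unshuffleE.
apply: eq_bigr => k _; apply: eq_bigr => s _.
have dE : map_tuple fst (zip_tuple d X) = d.
  by apply: val_inj; rewrite /= -/unzip1 unzip1_zip // !size_tuple.
have XE : map_tuple snd (zip_tuple d X) = X.
  by apply: val_inj; rewrite /= -/unzip2 unzip2_zip // !size_tuple.
rewrite dE; congr (_ *: _); rewrite /insert_term -{1 2}XE permute_map /=.
by rewrite map_take map_drop.
Qed.

Definition zip_component (d : seq int) (X : seq E) : seq (int * E) :=
  [seq (p.1, component p.1 p.2) | p <- zip d X].

(** The length is a separate variable [n], so that sequences differing in one entry are summed over
    the same type of degree tuples. *)
Lemma insertionE F G n (X : seq E) : size X = n ->
  insertion F G X = \sum_(d \in [set: n.-tuple int])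
    split_sum fst (insert_term F G) (zip_component d X).
Proof.
move=> <-; rewrite /insertion; apply: eq_fsbigr => d _.
rewrite sum_unshuffle_sum; congr split_sum.
apply: (@eq_from_nth _ (0, 0)).
  by rewrite size_map !size_zip !size_tuple.
move=> i; rewrite size_zip !size_tuple minnn => iX.
rewrite (nth_map (0, 0)) ?size_zip ?size_tuple ?minnn //.
rewrite !nth_zip ?size_tuple //=; congr (_, _).
rewrite (nth_map (Ordinal iX)) ?size_enum_ord // (nth_ord_enum (Ordinal iX) (Ordinal iX)).
by rewrite !(tnth_nth 0).
Qed.

(** A single vanishing component kills the term by multilinearity. Hence the sum over all degree
    tuples has finite support. *)
Lemma split_sum_zip_component_neq0 F G n (d : n.-tuple int) (X : n.-tuple E) :
  multilinear F -> multilinear G ->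
  split_sum fst (insert_term F G) (zip_component d X) != 0 ->
  forall i, supp (tnth X i) (tnth d i).
Proof.
move=> mF mG ne0 i; apply: contrapT => /negP/negPn/eqP e; move/eqP: ne0; apply.
have sz : (i < size (zip_component d X))%N.
  by rewrite size_map size_zip !size_tuple minnn.
rewrite -(cat_take_drop i (zip_component d X)) (drop_nth (0, 0)) //.
rewrite (nth_map (0, 0)) ?nth_zip ?size_tuple ?size_zip ?size_tuple ?minnn //=.
rewrite -!tnth_nth e.
have := split_sum_multilinear (take i (zip_component d X))
   (drop i.+1 (zip_component d X)) (tnth d i) (-1) 0 0
   (insert_term_bimultilinear mF mG).
by rewrite scaler0 addr0 scaleN1r addNr.
Qed.

Lemma insertion_multilinear F G :
  multilinear F -> multilinear G -> multilinear (insertion F G).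
Proof.
move=> mF mG s t a x y.
pose n := (size s + (size t).+1)%N.
have sz z : size (s ++ z :: t) == n by rewrite size_cat.
pose T z := Tuple (sz z).
pose A z := [set d : n.-tuple int | forall i, supp (tnth (T z) i) (tnth d i)].
have finA z : finite_set (A z).
  apply: (finite_set_tuple (A := fun i => supp (tnth (T z) i))) => i.
  by have [] := componentP (tnth (T z) i).
have finU : finite_set (A x `|` A y) by rewrite finite_setU.
rewrite !(insertionE _ _ (eqP (sz _))); apply: (fsbig_linear finU).
- by move=> d /(split_sum_zip_component_neq0 (X := T x) mF mG); left.
- by move=> d /(split_sum_zip_component_neq0 (X := T y) mF mG); right.
move=> d.
have szd : size s = size (take (size s) d).
  by rewrite size_takel ?size_tuple ?leq_addr.
have zE z : zip_component d (s ++ z :: t) =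
  zip_component (take (size s) d) s ++
  (nth 0 d (size s), component (nth 0 d (size s)) z) :: zip_component (drop (size s).+1 d) t.
  rewrite /zip_component -[in LHS](cat_take_drop (size s) d) zip_cat //.
  rewrite map_cat (drop_nth 0) // size_tuple /n; lia.
by rewrite !zE component_linear split_sum_multilinear //; apply: insert_term_bimultilinear.
Qed.
End Insertion.

(** * Forms evaluated on lists of homogeneous elements *)

Section HomogeneousElements.
Variables (K : fieldType) (E : gradedSpace K).

(** The degree is carried along because the vector does not determine it: 0 lies in every part. *)
Record helt := Helt { hdeg : int; hval : E; hvalP : part hdeg hval }.

Implicit Types (F G : vmap E) (d : int) (x y z : helt) (Z S U : seq helt).

Definition hvals Z : seq E := map hval Z.
Definition sumdeg Z : int := \sum_(z <- Z) hdeg z.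

Lemma sumdeg_cons z Z : sumdeg (z :: Z) = hdeg z + sumdeg Z.
Proof. exact: big_cons. Qed.

Lemma sumdeg0 : sumdeg [::] = 0.
Proof. exact: big_nil. Qed.

(** Adjacent transpositions generate the symmetric group, so this is graded symmetry in a form
    suited to induction on lists. *)
Definition swap_symmetric F : Prop := forall S U x y,
  F (hvals (S ++ x :: y :: U)) = ksign K (hdeg x * hdeg y) *: F (hvals (S ++ y :: x :: U)).

Definition hform d F : Prop :=
  [/\ multilinear F, swap_symmetric F
    & forall Z, part (sumdeg Z + d) (F (hvals Z))].

Lemma homogeneous_helt n (d : n.-tuple int) (X : n.-tuple E) : homogeneous d X ->
  exists Z : n.-tuple helt, d = map_tuple hdeg Z /\ X = map_tuple hval Z.
Proof.
move=> hX; exists [tuple Helt (hX i) | i < n].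
by split; apply: eq_from_tnth => i; rewrite tnth_map tnth_mktuple.
Qed.

Lemma helt_homogeneous n (Z : n.-tuple helt) :
  homogeneous (map_tuple hdeg Z) (map_tuple hval Z).
Proof. by move=> i; rewrite !tnth_map; apply: hvalP. Qed.

Lemma sumdeg_tuple n (Z : n.-tuple helt) :
  \sum_(i < n) tnth (map_tuple hdeg Z) i = sumdeg Z.
Proof.
by rewrite /sumdeg (big_tuple _ _ _ predT); apply: eq_bigr => i _; rewrite tnth_map.
Qed.

Lemma swap_symmetric_move F (P S U : seq helt) z : swap_symmetric F ->
  F (hvals (P ++ S ++ z :: U)) =
  ksign K (hdeg z * sumdeg S) *: F (hvals (P ++ z :: S ++ U)).
Proof.
move=> sF; elim: S P => [|y S IH] P /=; first by rewrite sumdeg0 mulr0 ksign0 scale1r.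
rewrite -cat_rcons IH cat_rcons sF scalerA -ksignD sumdeg_cons mulrDr.
by rewrite [hdeg y * _]mulrC [X in ksign K X]addrC.
Qed.

(** The original first entry [z] is moved back to the front by adjacent swaps; the rest is the
    induction hypothesis for the form with [z] as fixed first argument. *)
Lemma swap_symmetric_permute F n (Z : n.-tuple helt) (s : 'S_n) :
  swap_symmetric F ->
  F (hvals (permute s Z)) = koszul K (map_tuple hdeg Z) s *: F (hvals Z).
Proof.
elim: n F Z s => [|n IH] F Z s sF.
  by rewrite /koszul big_ord0 scale1r [permute _ _]tuple0 [Z]tuple0.
have [h _ hK] := lift_perm_bij n.
rewrite -(hK s); case: (h s) => j {}s /=; case/tupleP: Z => z Z.
have -> : map_tuple hdeg [tuple of z :: Z] = [tuple of hdeg z :: map_tuple hdeg Z].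
  exact: val_inj.
rewrite permute_lift_perm koszul_lift_perm (swap_symmetric_move [::]) //.
rewrite cat0s cat_take_drop (IH (fun X => F (hval z :: X))) => [|S U x y].
  by rewrite scalerA permute_map /sumdeg -(big_map hdeg predT id) map_take.
by rewrite (sF (z :: S)).
Qed.

Lemma hform_vform d F : vform d F <-> hform d F.
Proof.
split=> [[mF sF dF]|[mF sF dF]]; split=> //.
- have front S U z : F (hvals (S ++ z :: U)) =
      ksign K (hdeg z * sumdeg S) *: F (hvals (z :: S ++ U)).
    have jP : (size S < (size (S ++ U)).+1)%N by rewrite size_cat ltnS leq_addr.
    (* Being the identity on the other entries, this permutation only carries the first entry to
       place [size S]. *)
    have := sF _ _ _ (lift_perm (Ordinal jP) ord0 1%g)
      (helt_homogeneous [tuple of z :: in_tuple (S ++ U)]).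
    have -> : map_tuple hdeg [tuple of z :: in_tuple (S ++ U)] =
        [tuple of hdeg z :: map_tuple hdeg (in_tuple (S ++ U))] by exact: val_inj.
    rewrite permute_map /= permute_lift_perm koszul_lift_perm !permute1 koszul1 mulr1.
    rewrite (_ : take (Ordinal jP) (in_tuple _) = S); last exact: take_size_cat.
    rewrite (_ : drop (Ordinal jP) (in_tuple _) = U); last exact: drop_size_cat.
    rewrite (_ : take _ (map_tuple _ _) = map hdeg S) ?big_map //.
    by rewrite -map_take /= take_size_cat.
  (* Bringing [y] to the front on both sides gives the same value of [F]; the signs differ by that
     of passing [x]. *)
  move=> S U x y; rewrite -[S ++ x :: _]cat_rcons front cat_rcons front.
  rewrite scalerA -ksignD /sumdeg big_rcons -/(sumdeg S) /=.
  by rewrite mulrDr [hdeg x * _]mulrC [X in ksign K X]addrC.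
- move=> Z; rewrite -[Z]/(tval (in_tuple Z)) -sumdeg_tuple.
  exact: dF (helt_homogeneous _).
- by move=> n e X s /homogeneous_helt[Z [-> ->]]; rewrite permute_map swap_symmetric_permute.
- by move=> n e X /homogeneous_helt[Z [-> ->]]; rewrite sumdeg_tuple; apply: dF.
Qed.

Lemma multilinear_sum F (I : Type) (r : seq I) (f : I -> E) s t : multilinear F ->
  F (s ++ (\sum_(i <- r) f i) :: t) = \sum_(i <- r) F (s ++ f i :: t).
Proof.
move=> mF; elim: r => [|i r IH]; first by rewrite !big_nil multilinear_slot0.
by rewrite !big_cons -IH -[f i]scale1r mF !scale1r.
Qed.

(** Homogeneous elements span: the entries are expanded into components from left to right, and the
    prefix already treated is the homogeneous list [Z]. *)
Lemma multilinear_eq F G : multilinear F -> multilinear G ->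
  (forall Z, F (hvals Z) = G (hvals Z)) -> F = G.
Proof.
move=> mF mG FG; apply/funext => X; rewrite -[X]/(hvals [::] ++ X).
elim: X [::] => [|x X IH] Z; first by rewrite cats0.
have [px fx ->] := componentP x.
rewrite (fsbig_finite_support fx) // !multilinear_sum //; apply: eq_bigr => i _.
by have := IH (rcons Z (Helt (px i))); rewrite /hvals map_rcons !cat_rcons.
Qed.

(** On homogeneous arguments only the tuple of their actual degrees can contribute to the expansion
    into components. *)
Lemma insertion_hvals F G Z : multilinear F -> multilinear G ->
  insertion F G (hvals Z) = split_sum hdeg (fun A B => G (F (hvals A) :: hvals B)) Z.
Proof.
move=> mF mG; rewrite (@insertionE _ _ _ _ (size Z)) ?size_map //.
pose d0 := map_tuple hdeg (in_tuple Z).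
rewrite (fsbig_finite_support (finite_set1 d0)) => [|d].
  rewrite -fsbig_finite // fsbig_set1.
  have -> : zip_component d0 (hvals Z) = [seq (hdeg z, hval z) | z <- Z].
    rewrite /d0 /zip_component /=; elim: Z {d0} => //= z Z ->.
    by rewrite (component_part _ (hvalP z)) eqxx.
  rewrite (split_sum_map (dgT := hdeg)) //; apply: eq_split_sum => A B.
  by rewrite /insert_term -!map_comp.
have -> : hvals Z = map_tuple hval (in_tuple Z) by [].
move=> /(split_sum_zip_component_neq0 mF mG) h /=.
apply: eq_from_tnth => i; move: (h i); rewrite !tnth_map /supp /=.
by rewrite (component_part _ (hvalP _)); case: (tnth d i =P _) => // _; rewrite eqxx.
Qed.

End HomogeneousElements.

(** * The derivation rule and the pre-Lie identity *)

Section PreLie.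
Variables (K : fieldType) (E : gradedSpace K).
Implicit Types (F G H : vmap E) (d f g h : int) (x y z : helt E) (Z S U : seq (helt E)).

(** The operation written [d_z] in the overview. *)
Definition contract z F : vmap E := fun X => F (hval z :: X).

Definition lincomb a F G : vmap E := fun X => F X + a *: G X.

Lemma hform_contract d z F : hform d F -> hform (hdeg z + d) (contract z F).
Proof.
move=> [mF sF dF]; split=> [s t a x y|S U x y|Z].
- exact: (mF (hval z :: s)).
- exact: (sF (z :: S)).
- by rewrite addrCA addrA -sumdeg_cons; apply: dF.
Qed.

Lemma hform_lincomb d a F G : hform d F -> hform d G -> hform d (lincomb a F G).
Proof.
move=> [mF sF dF] [mG sG dG]; split=> [s t b x y|S U x y|Z]; rewrite /lincomb.
- by rewrite mF mG !scalerDr !scalerA addrACA [b * a]mulrC.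
- by rewrite sF sG scalerDr !scalerA [_ * a]mulrC.
- by apply: partD => //; apply: partZ.
Qed.

Lemma hform_eq d d' F G : hform d F -> hform d' G ->
  (forall Z, F (hvals Z) = G (hvals Z)) -> F = G.
Proof. by move=> [mF _ _] [mG _ _]; apply: multilinear_eq. Qed.

Lemma hform_nil d F : hform d F -> part d (F [::]).
Proof. by case=> _ _ dF; have := dF [::]; rewrite sumdeg0 add0r. Qed.

Lemma insertion_nil F G : multilinear F -> multilinear G ->
  insertion F G [::] = G [:: F [::]].
Proof. by move=> mF mG; rewrite (insertion_hvals [::] mF mG). Qed.

(** Either [z] enters [F], or it moves past the entries [A] of [F] and then, to become the first
    argument of [G], past the value of [F], of degree [sumdeg A + f]. The two contributions of
    [sumdeg A] cancel and leave [hdeg z * f]. *)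
Lemma insertion_cons f g F G z Z : hform f F -> hform g G ->
  insertion F G (hval z :: hvals Z) =
  insertion (contract z F) G (hvals Z)
  + ksign K (hdeg z * f) *: insertion F (contract z G) (hvals Z).
Proof.
move=> hF hG; have [mF sF dF] := hF; have [mG sG dG] := hG.
have [mzF _ _] := hform_contract z hF; have [mzG _ _] := hform_contract z hG.
rewrite (insertion_hvals (z :: Z)) // !insertion_hvals //=; congr (_ + _).
rewrite -split_sumZ; apply: eq_split_sum => A B.
have := sG [::] B (Helt (dF A)) z; rewrite /= /hvals /= => ->.
rewrite scalerA -ksignD. congr (_ *: _). apply: (@eq_ksign K (hdeg z * sumdeg A)).
by rewrite -/(sumdeg A); ring.
Qed.

Lemma insertion_lincombl a F F' G Z :
  multilinear F -> multilinear F' -> multilinear G ->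
  insertion (lincomb a F F') G (hvals Z) =
  insertion F G (hvals Z) + a *: insertion F' G (hvals Z).
Proof.
move=> mF mF' mG.
have mL : multilinear (lincomb a F F').
  by move=> s t b x y; rewrite /lincomb mF mF' !scalerDr !scalerA addrACA [b * a]mulrC.
rewrite !insertion_hvals // [RHS]addrC -split_sumP; apply: eq_split_sum => A B.
by rewrite /lincomb addrC (mG [::]).
Qed.

Lemma insertion_lincombr a F G G' Z :
  multilinear F -> multilinear G -> multilinear G' ->
  insertion F (lincomb a G G') (hvals Z) =
  insertion F G (hvals Z) + a *: insertion F G' (hvals Z).
Proof.
move=> mF mG mG'.
have mL : multilinear (lincomb a G G').
  by move=> s t b x y; rewrite /lincomb mG mG' !scalerDr !scalerA addrACA [b * a]mulrC.
rewrite !insertion_hvals // [RHS]addrC -split_sumP; apply: eq_split_sum => A B.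
by rewrite /lincomb addrC.
Qed.

Lemma insertion_swapl d F G x y Z : hform d F -> multilinear G ->
  insertion (contract y (contract x F)) G (hvals Z) =
  ksign K (hdeg x * hdeg y) *: insertion (contract x (contract y F)) G (hvals Z).
Proof.
move=> hF mG; have [mxyF _ _] := hform_contract x (hform_contract y hF).
have [myxF _ _] := hform_contract y (hform_contract x hF).
rewrite !insertion_hvals // -split_sumZ; apply: eq_split_sum => A B.
have [_ sF _] := hF; rewrite /contract (sF [::] A x y) -[_ *: F _]addr0.
by rewrite (mG [::]) (multilinear_slot0 [::]) // addr0.
Qed.

Lemma insertion_swapr d F G x y Z : multilinear F -> hform d G ->
  insertion F (contract y (contract x G)) (hvals Z) =
  ksign K (hdeg x * hdeg y) *: insertion F (contract x (contract y G)) (hvals Z).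
Proof.
move=> mF hG; have [mxyG _ _] := hform_contract x (hform_contract y hG).
have [myxG _ _] := hform_contract y (hform_contract x hG).
rewrite !insertion_hvals // -split_sumZ; apply: eq_split_sum => A B.
have -> // : contract y (contract x G) =
  (fun X => ksign K (hdeg x * hdeg y) *: contract x (contract y G) X).
have [_ sG _] := hG; apply: multilinear_eq => //.
  by move=> s t a u v; rewrite mxyG scalerDr !scalerA mulrC.
by move=> U; apply: (sG [::]).
Qed.

(** The derivation rule carries symmetry and degree through an induction on the arguments. To swap
    the first two, it is applied twice: terms with both in [F] or both in [G] use the symmetry of
    that form, and the two mixed terms change places. *)
Lemma hform_insertion f g F G : hform f F -> hform g G -> hform (f + g) (insertion F G).
Proof.
move=> hF hG; have [mF _ _] := hF; have [mG _ _] := hG.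
split; first exact: insertion_multilinear.
- move=> S U x y; elim: S => [|z S IH] in f g F G hF hG mF mG *.
    have hxF := hform_contract x hF; have hyF := hform_contract y hF.
    have hxG := hform_contract x hG; have hyG := hform_contract y hG.
    have [mxF _ _] := hxF; have [mxG _ _] := hxG.
    have [mxyF _ _] := hform_contract x hyF.
    have [mxyG _ _] := hform_contract x hyG.
    rewrite /= !(insertion_cons _ (_ :: _) hF hG) /=.
    rewrite (insertion_cons _ _ hxF hG) (insertion_cons _ _ hF hxG).
    rewrite (insertion_cons _ _ hyF hG) (insertion_cons _ _ hF hyG).
    rewrite (insertion_swapl x y U hF mG) (insertion_swapr x y U mF hG).
    rewrite !scalerDr !scalerA -!ksignD.
    rewrite [LHS]addrACA; congr (_ + _ *: _ + (_ *: _ + _ *: _)); last by congr ksign; ring.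
      by apply/esym/(@eq_ksign K (hdeg x * hdeg y)); ring.
    by congr ksign; ring.
  have hzF := hform_contract z hF; have hzG := hform_contract z hG.
  have [mzF _ _] := hzF; have [mzG _ _] := hzG.
  rewrite /= !(insertion_cons z (S ++ _) hF hG) scalerDr.
  rewrite (IH _ _ _ _ hzF hG mzF mG) (IH _ _ _ _ hF hzG mF mzG).
  by rewrite !scalerA [ksign K (hdeg z * f) * _]mulrC.
- move=> Z; elim: Z => [|z Z IH] in f g F G hF hG mF mG *.
    have [_ _ dG] := hG; have := dG [:: Helt (hform_nil hF)].
    by rewrite insertion_nil // sumdeg_cons !sumdeg0 addr0 add0r.
  have hzF := hform_contract z hF; have hzG := hform_contract z hG.
  have [mzF _ _] := hzF; have [mzG _ _] := hzG.
  rewrite /= (insertion_cons z Z hF hG) sumdeg_cons; apply: partD.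
    have -> : hdeg z + sumdeg Z + (f + g) = sumdeg Z + (hdeg z + f + g) by ring.
    exact: IH.
  have -> : hdeg z + sumdeg Z + (f + g) = sumdeg Z + (f + (hdeg z + g)) by ring.
  by apply: partZ; exact: IH.
Qed.

Lemma contract_insertion f g F G z : hform f F -> hform g G ->
  contract z (insertion F G) =
  lincomb (ksign K (hdeg z * f)) (insertion (contract z F) G) (insertion F (contract z G)).
Proof.
move=> hF hG; have hl := hform_contract z (hform_insertion hF hG).
have h1 := hform_insertion (hform_contract z hF) hG.
have h2 := hform_insertion hF (hform_contract z hG).
have e : f + (hdeg z + g) = hdeg z + f + g by ring.
rewrite e in h2.
apply: (hform_eq hl (hform_lincomb _ h1 h2)) => Z.
exact: (insertion_cons z Z hF hG).
Qed.

Definition associator F G H : vmap E :=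
  lincomb (-1) (insertion F (insertion G H)) (insertion (insertion F G) H).

(** The rule for insertions is used twice: [z] crosses [F] to reach [G], and both [F] and [G] to
    reach [H], whence the two signs. *)
Lemma associator_cons f g h F G H z Z : hform f F -> hform g G -> hform h H ->
  associator F G H (hval z :: hvals Z) =
  associator (contract z F) G H (hvals Z)
  + ksign K (hdeg z * f) *: associator F (contract z G) H (hvals Z)
  + ksign K (hdeg z * f + hdeg z * g) *: associator F G (contract z H) (hvals Z).
Proof.
move=> hF hG hH; have hzF := hform_contract z hF.
have hzG := hform_contract z hG; have hzH := hform_contract z hH.
have [mF _ _] := hF; have [mH _ _] := hH; have [mzH _ _] := hzH.
rewrite /associator /lincomb (insertion_cons _ _ hF (hform_insertion hG hH)).
rewrite (insertion_cons _ _ (hform_insertion hF hG) hH).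
rewrite (contract_insertion _ hF hG) (contract_insertion _ hG hH).
rewrite insertion_lincombr; first last.
- by have [] := hform_insertion hG hzH.
- by have [] := hform_insertion hzG hH.
- by [].
rewrite insertion_lincombl; first last.
- by [].
- by have [] := hform_insertion hF hzG.
- by have [] := hform_insertion hzF hG.
rewrite mulrDr ksignD !scaleN1r !scalerBr !scalerDr !scalerA !opprD !addrA.
set a1 := insertion (contract z F) _ _; set a2 := _ *: insertion F (insertion (contract z G) _) _.
set a3 := _ *: insertion F (insertion G (contract z H)) _.
set b1 := insertion (insertion (contract z F) _) _ _.
set b2 := _ *: insertion (insertion F (contract z G)) _ _.
set b3 := _ *: insertion (insertion F G) (contract z H) _.
rewrite -!addrA; congr (_ + _).
rewrite [RHS]addrCA; congr (_ + _).
rewrite [LHS]addrCA; congr (_ + _); rewrite [RHS]addrCA; congr (_ + _).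
Qed.

Lemma insertion_preLie f g h F G H Z : hform f F -> hform g G -> hform h H ->
  associator F G H (hvals Z) = ksign K (f * g) *: associator G F H (hvals Z).
Proof.
elim: Z => [|z Z IH] in f g h F G H *; move=> hF hG hH.
  have [mF _ _] := hF; have [mG _ _] := hG; have [mH sH _] := hH.
  have [mFG _ _] := hform_insertion hF hG; have [mGF _ _] := hform_insertion hG hF.
  have [mFH _ _] := hform_insertion hF hH; have [mGH _ _] := hform_insertion hG hH.
  (* With the 0-forms of [F] and [G] as homogeneous elements the derivation rule applies to them. On
     the left [H(G(u))] cancels and [(-1)^(f g) H(u, v)] is left; likewise on the right with [u] and
     [v] exchanged. *)
  pose u := Helt (hform_nil hF); pose v := Helt (hform_nil hG).
  rewrite /associator /lincomb !insertion_nil //.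
  rewrite (insertion_cons u [::] hG hH) (insertion_cons v [::] hF hH).
  have [muG _ _] := hform_contract u hG; have [muH _ _] := hform_contract u hH.
  have [mvF _ _] := hform_contract v hF; have [mvH _ _] := hform_contract v hH.
  rewrite !insertion_nil // /contract /= !scaleN1r.
  rewrite addrAC subrr add0r addrAC subrr add0r scalerA.
  rewrite (sH [::] [::] u v) /= scalerA; congr (_ *: _).
  by rewrite -!ksignD; congr ksign; rewrite [g * f]mulrC.
have hzF := hform_contract z hF.
have hzG := hform_contract z hG; have hzH := hform_contract z hH.
rewrite /= (associator_cons z Z hF hG hH) (associator_cons z Z hG hF hH).
rewrite (IH _ _ _ _ _ _ hzF hG hH) (IH _ _ _ _ _ _ hF hzG hH) (IH _ _ _ _ _ _ hF hG hzH).
(* A contracted form has its degree shifted by [hdeg z]; these identities reconcile the signs of the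
   three instances of the induction hypothesis. *)
have e1 : ksign K ((hdeg z + f) * g) = ksign K (f * g + hdeg z * g) by congr ksign; ring.
have e2 : ksign K (hdeg z * f + f * (hdeg z + g)) = ksign K (f * g).
  by apply: (@eq_ksign K (hdeg z * f)); ring.
have e3 : ksign K (hdeg z * f + hdeg z * g + f * g) =
          ksign K (f * g + (hdeg z * g + hdeg z * f)) by congr ksign; ring.
by rewrite !scalerDr !scalerA -!ksignD [X in X + _]addrC e1 e2 e3.
Qed.
End PreLie.

(** * Curved structures as square-zero forms, and the iterated bracket *)

Section CurvedLinfty.
Variables (K : fieldType) (E : gradedSpace K).
Implicit Types (F G H mu N : vmap E).

(** The term [k = 0] has the identity as its only unshuffle; set apart, it is the curvature term of
    the structure equations. *)
Lemma insertion_homogeneous F G n (d : n.-tuple int) (X : n.-tuple E) :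
  multilinear F -> multilinear G -> homogeneous d X ->
  insertion F G X =
  G (F [::] :: X) + \sum_(1 <= k < n.+1) unshuffle_sum k F G d X.
Proof.
move=> mF mG /homogeneous_helt[Z [-> ->]].
have -> : insertion F G (map_tuple (@hval K E) Z) =
    split_sum fst (insert_term F G) (zip (map_tuple (@hdeg K E) Z) (map_tuple (@hval K E) Z)).
  rewrite (insertion_hvals Z) // /= zip_map (split_sum_map (dgT := @hdeg _ _)) //.
  by apply: eq_split_sum => A B; rewrite /insert_term -!map_comp.
rewrite -sum_unshuffle_sum.
rewrite -(big_mkord predT (fun k => unshuffle_sum k F G _ _)) big_ltn //; congr (_ + _).
rewrite /unshuffle_sum (big_pred1 1%g); last exact: unshuffle0_eq.
by rewrite koszul1 permute1 scale1r take0 drop0.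
Qed.

(** The structure equations are the arity 0 and positive arity parts of the square of [mu] on
    homogeneous arguments; multilinearity extends them to all arguments. *)
Lemma curved_LinftyP mu :
  curved_Linfty mu <-> hform 1 mu /\ forall X, insertion mu mu X = 0.
Proof.
split=> [[/hform_vform hmu mu0 muS]|[hmu mu0]].
  split=> //; have [mmu _ _] := hmu.
  suff -> : insertion mu mu = fun=> 0 by [].
  apply: multilinear_eq; first exact: insertion_multilinear.
    by move=> s t a x y; rewrite scaler0 addr0.
  case=> [|z Z]; first by rewrite insertion_nil.
  have hZ := helt_homogeneous (in_tuple (z :: Z)).
  by rewrite -(muS _ _ _ _ hZ) // -insertion_homogeneous.
have [mmu _ _] := hmu; split; first exact/hform_vform.
  by rewrite -insertion_nil.
by move=> n d X _ hX; rewrite -insertion_homogeneous.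
Qed.

Lemma rn_bracket01 N mu :
  rn_bracket 0 1 N mu = lincomb (-1) (insertion N mu) (insertion mu N).
Proof. by apply/funext => X; rewrite /rn_bracket /lincomb mul0r scaleNr. Qed.

Lemma rn_bracket11 F G X :
  rn_bracket 1 1 F G X = insertion F G X + insertion G F X.
Proof. by rewrite /rn_bracket mulr1 expr1z scaleN1r opprK. Qed.

Lemma insertion0l G Z : multilinear G -> insertion (fun=> 0) G (hvals Z) = 0.
Proof.
move=> mG; have m0 : multilinear (fun=> 0 : E).
  by move=> s t a x y; rewrite scaler0 addr0.
rewrite insertion_hvals // -[RHS](split_sum0 _ (@hdeg _ _) Z).
by apply: eq_split_sum => A B; rewrite (multilinear_slot0 [::]).
Qed.

Lemma insertion0r F Z : multilinear F -> insertion F (fun=> 0) (hvals Z) = 0.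
Proof.
move=> mF; have m0 : multilinear (fun=> 0 : E).
  by move=> s t a x y; rewrite scaler0 addr0.
by rewrite insertion_hvals // split_sum0.
Qed.

Lemma bracket_square mu N : (2%:R : K) != 0 ->
  hform 1 mu -> (forall X, insertion mu mu X = 0) -> hform 0 N ->
  let A := rn_bracket 0 1 N mu in
  hform 1 A /\
  forall X, rn_bracket 1 1 mu (rn_bracket 0 1 N A) X = - insertion A A X - insertion A A X.
Proof.
move=> two0 hm mm0 hN A.
have eqN0 (x : E) : x = - x -> x = 0.
  move=> /eqP; rewrite -addr_eq0 -mulr2n -scaler_nat scaler_eq0 (negPf two0) /=.
  by move/eqP.
have mm : insertion mu mu = fun=> 0 by apply/funext.
have hNm : hform 1 (insertion N mu) by rewrite -[1]add0r; apply: hform_insertion.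
have hmN : hform 1 (insertion mu N) by rewrite -[1]addr0; apply: hform_insertion.
have AE : A = lincomb (-1) (insertion N mu) (insertion mu N) := rn_bracket01 N mu.
have hA : hform 1 A by rewrite AE; apply: hform_lincomb.
split=> //.
have hNA : hform 1 (insertion N A) by rewrite -[1]add0r; apply: hform_insertion.
have hAN : hform 1 (insertion A N) by rewrite -[1]addr0; apply: hform_insertion.
set B := rn_bracket 0 1 N A.
have BE : B = lincomb (-1) (insertion N A) (insertion A N) := rn_bracket01 N A.
have hB : hform 1 B by rewrite BE; apply: hform_lincomb.
have hAm := hform_insertion hA hm; have hmA := hform_insertion hm hA.
have ml F d : hform d F -> multilinear F by case.
have mN := ml _ _ hN; have m_m := ml _ _ hm; have mA := ml _ _ hA.
have mNm := ml _ _ hNm; have mmN := ml _ _ hmN.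
have assocE F G H Z : associator F G H (hvals Z) =
    insertion F (insertion G H) (hvals Z) - insertion (insertion F G) H (hvals Z).
  by rewrite /associator /lincomb scaleN1r.
have Al G Z : multilinear G -> insertion A G (hvals Z) =
    insertion (insertion N mu) G (hvals Z) - insertion (insertion mu N) G (hvals Z).
  by move=> mG; rewrite AE insertion_lincombl // scaleN1r.
have Ar F Z : multilinear F -> insertion F A (hvals Z) =
    insertion F (insertion N mu) (hvals Z) - insertion F (insertion mu N) (hvals Z).
  by move=> mF; rewrite AE insertion_lincombr // scaleN1r.
(* As [mu] is odd, the associator of [mu, mu, N] equals its own negative, so it vanishes; its other
   term contains the square of [mu]. *)
have mmN0 Z : insertion mu (insertion mu N) (hvals Z) = 0.
  have := insertion_preLie Z hm hm hN; rewrite mulr1 /ksign expr1z scaleN1r.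
  by move/eqN0; rewrite assocE mm insertion0l // subr0.
(* This is the pre-Lie identity for [N, mu, mu], where [N.(mu.mu)] and [mu.(mu.N)] vanish. *)
have anticomm : lincomb 1 (insertion A mu) (insertion mu A) = fun=> 0.
  apply: multilinear_eq; first exact: (ml _ _ (hform_lincomb _ hAm hmA)).
    by move=> s t a x y; rewrite scaler0 addr0.
  move=> Z; rewrite /lincomb scale1r Al // Ar // mmN0 subr0.
  have := insertion_preLie Z hN hm hm; rewrite mul0r ksign0 scale1r !assocE.
  rewrite mm insertion0r // sub0r => e.
  by rewrite -[X in X - _]opprK e opprB addrAC subrK subrr.
have NAm Z : insertion N (insertion A mu) (hvals Z) = - insertion N (insertion mu A) (hvals Z).
  apply/eqP; rewrite -addr_eq0 -[X in _ + X]scale1r -insertion_lincombr //.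
  - by rewrite anticomm insertion0r.
  - exact: ml hAm.
  - exact: ml hmA.
have AmN Z : insertion (insertion A mu) N (hvals Z) = - insertion (insertion mu A) N (hvals Z).
  apply/eqP; rewrite -addr_eq0 -[X in _ + X]scale1r -insertion_lincombl //.
  - by rewrite anticomm insertion0l.
  - exact: ml hAm.
  - exact: ml hmA.
(* Stated as an equality of multilinear maps, so that it can be checked on homogeneous arguments
   alone. *)
suff e : lincomb 1 (insertion mu B) (insertion B mu) = fun X => -2 *: insertion A A X.
  move=> X; rewrite rn_bracket11.
  have := congr1 (fun L : vmap E => L X) e; rewrite /lincomb scale1r => ->.
  by rewrite scaleNr scaler_nat mulr2n opprD.
have mB := ml _ _ hB.
apply: multilinear_eq.
- apply: ml (hform_lincomb 1 (hform_insertion hm hB) (hform_insertion hB hm)).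
- have mAA := ml _ _ (hform_insertion hA hA).
  by move=> s t a x y; rewrite mAA scalerDr !scalerA mulrC.
move=> Z; rewrite /lincomb scale1r {1 2}BE.
have mNA := ml _ _ hNA; have mAN := ml _ _ hAN.
rewrite insertion_lincombr // insertion_lincombl //.
rewrite !scaleN1r scaleNr scaler_nat mulr2n opprD.
(* The instances [N, mu, A], then [A, mu, N], then [N, A, mu] rewrite [mu.(N.A)], [mu.(A.N)] and
   [(N.A).mu - (A.N).mu] respectively; in the sum, [N.(mu.A)] cancels. *)
have := insertion_preLie Z hN hm hA.
have := insertion_preLie Z hA hm hN.
have := insertion_preLie Z hN hA hm.
rewrite !assocE !mulr1 ksign0 !scale1r {1}/ksign expr1z scaleN1r NAm AmN.
(* One copy of [A.A] is expanded in its left argument and the other in its right one, since both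
   shapes occur in what remains. *)
rewrite {1}[insertion A A _]Al // {1}[insertion A A _]Ar //.
move=> e1 e2 e3.
have -> : insertion mu (insertion N A) (hvals Z) =
    insertion N (insertion mu A) (hvals Z) - insertion (insertion N mu) A (hvals Z)
    + insertion (insertion mu N) A (hvals Z) by rewrite e3 subrK.
have -> : insertion mu (insertion A N) (hvals Z) = - insertion A (insertion mu N) (hvals Z).
  by move: e2; rewrite opprK opprB addrC => /addrI ->; rewrite opprK.
have -> : insertion (insertion N A) mu (hvals Z) - insertion (insertion A N) mu (hvals Z) =
    - insertion N (insertion mu A) (hvals Z) - insertion A (insertion N mu) (hvals Z).
  move/eqP: e1; rewrite eq_sym subr_eq => /eqP ->.
  by rewrite opprD opprB opprK addrA [in RHS](addrC (- _)) addrK.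
rewrite opprK [LHS]addrCA !addrA addNr add0r !opprB addrA.
by congr (_ + _ - _); rewrite addrC.
Qed.

End CurvedLinfty.

Theorem proposition2p3 (R : realType) (K : fieldType)
    (hK : K = R :> fieldType \/ K = R[i] :> fieldType)
    (E : gradedSpace K) (mu N : vmap E)
    (hmu : curved_Linfty mu) (hN : vform 0 N) :
  weak_nijenhuis mu N <-> curved_Linfty (rn_bracket 0 1 N mu).
Proof.
(* Needed to pass from [2 A.A = 0] to [A.A = 0], and inside [bracket_square] for an element equal to
   its negative. *)
have two0 : (2%:R : K) != 0 by case: hK => ->; rewrite pnatr_eq0.
have [hm mm0] := (curved_LinftyP mu).1 hmu.
have [hA AA] := bracket_square two0 hm mm0 ((hform_vform 0 N).1 hN).
rewrite curved_LinftyP; split=> [weak|[_ A0] X]; last by rewrite AA !A0 subr0 oppr0.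
split=> // X; have := weak X; rewrite AA => /eqP.
by rewrite -opprD oppr_eq0 -mulr2n -scaler_nat scaler_eq0 (negPf two0) => /eqP.
Qed.
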